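(* Let $\bar x\in X$ be a feasible point of the or-constrained program (MPOC). Then $\bar x$ is S-stationary for (MPOC) if and only if $\bar x$ is a Karush--Kuhn--Tucker (KKT) point of the smooth nonlinear program $$\text{(MPOC}(\varphi_{\mathrm{KS}})\text{)}\qquad \min_x f(x)\ \text{ s.t. }\ g_i(x)\le 0\ (i\in\mathcal M),\quad h_j(x)=0\ (j\in\mathcal P),\quad \varphi_{\mathrm{KS}}(G_l(x),H_l(x))\le 0\ (l\in\mathcal Q).$$
   Context: Let $n,m,p,q$ be positive integers, $\mathcal M:=\{1,\dots,m\}$, $\mathcal P:=\{1,\dots,p\}$, $\mathcal Q:=\{1,\dots,q\}$, and let $f,g_i,h_j,G_l,H_l\colon\mathbb R^n\to\mathbb R$ be continuously differentiable for all $i\in\mathcal M$, $j\in\mathcal P$, $l\in\mathcal Q$. The program (MPOC) is: minimize $f(x)$ subject to $g_i(x)\le 0$ ($i\in\mathcal M$), $h_j(x)=0$ ($j\in\mathcal P$), and ($G_l(x)\le 0$ or $H_l(x)\le 0$) for all $l\in\mathcal Q$. Its feasible set is $X\subset\mathbb R^n$. The Kanzow--Schwartz function $\varphi_{\mathrm{KS}}\colon\mathbb R^2\to\mathbb R$ is $\varphi_{\mathrm{KS}}(a,b):=ab$ if $a+b\ge 0$ and $\varphi_{\mathrm{KS}}(a,b):=-\tfrac12(a^2+b^2)$ if $a+b<0$; it is continuously differentiable, and $\varphi_{\mathrm{KS}}(a,b)\le 0$ if and only if $a\le0$ or $b\le 0$, so (MPOC$(\varphi_{\mathrm{KS}})$)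 has feasible set $X$. For $\bar x\in X$ put $I^g(\bar x):=\{i\in\mathcal M: g_i(\bar x)=0\}$, $I^{0+}(\bar x):=\{l\in\mathcal Q: G_l(\bar x)=0,\ H_l(\bar x)>0\}$, $I^{+0}(\bar x):=\{l\in\mathcal Q: G_l(\bar x)>0,\ H_l(\bar x)=0\}$, $I^{00}(\bar x):=\{l\in\mathcal Q: G_l(\bar x)=0,\ H_l(\bar x)=0\}$. A point $\bar x\in X$ is W-stationary for (MPOC) if there are multipliers $\lambda_i\ge0$ ($i\in I^g(\bar x)$), $\rho_j\in\mathbb R$ ($j\in\mathcal P$), $\mu_l\ge 0$ ($l\in I^{0+}(\bar x)\cup I^{00}(\bar x)$), $\nu_l\ge0$ ($l\in I^{+0}(\bar x)\cup I^{00}(\bar x)$) with $$0=\nabla f(\bar x)+\sum_{i\in I^g(\bar x)}\lambda_i\nabla g_i(\bar x)+\sum_{j\in\mathcal P}\rho_j\nabla h_j(\bar x)+\sum_{l\in I^{0+}(\bar x)\cup I^{00}(\bar x)}\mu_l\nabla G_l(\bar x)+\sum_{l\in I^{+0}(\bar x)\cup I^{00}(\bar x)}\nu_l\nabla H_l(\bar x).$$ It is S-stationary if such multipliers exist which additionally satisfy $\mu_l=0$ and $\nu_l=0$ for all $l\in I^{00}(\bar x)$. A feasible point $\bar x$ of a smooth nonlinear program $\min f$ s.t. $c_i\le 0$, $h_j=0$ is a KKT point if there are multipliers $\lambda_i\ge 0$ for the active inequality constraints ($c_i(\bar x)=0$) and $\rho_j\in\mathbb R$ with $0=\nabla f(\bar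 x)+\sum_{i:\,c_i(\bar x)=0}\lambda_i\nabla c_i(\bar x)+\sum_j\rho_j\nabla h_j(\bar x)$. *)

(* Defs.v *)
From HB Require Import structures.
From mathcomp Require Import all_boot all_order all_algebra.
From mathcomp Require Import all_classical all_reals all_analysis.

Set Implicit Arguments.
Unset Strict Implicit.
Unset Printing Implicit Defensive.

Import Order.TTheory GRing.Theory Num.Theory.
Import numFieldNormedType.Exports.

Local Open Scope ring_scope.

Definition gradient (R : realType) (n : nat) (f : 'rV[R]_n -> R)
    (x : 'rV[R]_n) : 'rV[R]_n :=
  \row_(i < n) derive f x (delta_mx 0 i).

Definition continuously_differentiable (R : realType) (n : nat)
    (f : 'rV[R]_n -> R) : Prop :=
  (forall x, differentiable f x) /\ continuous (gradient f).

Record nlp (R : realType) (n : nat) (I J : finType) := Nlp {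
  nlp_f : 'rV[R]_n -> R;
  nlp_c : I -> 'rV[R]_n -> R;
  nlp_h : J -> 'rV[R]_n -> R }.

Definition nlp_feasible (R : realType) (n : nat) (I J : finType)
    (N : nlp R n I J) (x : 'rV[R]_n) : Prop :=
  (forall i, nlp_c N i x <= 0) /\ (forall j, nlp_h N j x = 0).

(* Here and below a multiplier is a total function on the index type; its
   values outside the index set on which it is constrained are never used. *)
Definition KKT_point (R : realType) (n : nat) (I J : finType)
    (N : nlp R n I J) (x : 'rV[R]_n) : Prop :=
  nlp_feasible N x /\
  exists (lambda : I -> R) (rho : J -> R),
    (forall i, nlp_c N i x = 0 -> 0 <= lambda i) /\
    0 = gradient (nlp_f N) x
        + \sum_(i | nlp_c N i x == 0) lambda i *: gradient (nlp_c N i) x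
        + \sum_j rho j *: gradient (nlp_h N j) x.

Record mpoc (R : realType) (n m p q : nat) := Mpoc {
  mpoc_f : 'rV[R]_n -> R;
  mpoc_g : 'I_m -> 'rV[R]_n -> R;
  mpoc_h : 'I_p -> 'rV[R]_n -> R;
  mpoc_G : 'I_q -> 'rV[R]_n -> R;
  mpoc_H : 'I_q -> 'rV[R]_n -> R }.

Definition mpoc_feasible (R : realType) (n m p q : nat)
    (P : mpoc R n m p q) (x : 'rV[R]_n) : Prop :=
  [/\ forall i, mpoc_g P i x <= 0,
      forall j, mpoc_h P j x = 0
    & forall l, mpoc_G P l x <= 0 \/ mpoc_H P l x <= 0].

Definition I_g (R : realType) (n m p q : nat) (P : mpoc R n m p q)
    (x : 'rV[R]_n) : {set 'I_m} :=
  [set i | mpoc_g P i x == 0]%SET.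

Definition I_0p (R : realType) (n m p q : nat) (P : mpoc R n m p q)
    (x : 'rV[R]_n) : {set 'I_q} :=
  [set l | (mpoc_G P l x == 0) && (mpoc_H P l x > 0)]%SET.

Definition I_p0 (R : realType) (n m p q : nat) (P : mpoc R n m p q)
    (x : 'rV[R]_n) : {set 'I_q} :=
  [set l | (mpoc_G P l x > 0) && (mpoc_H P l x == 0)]%SET.

Definition I_00 (R : realType) (n m p q : nat) (P : mpoc R n m p q)
    (x : 'rV[R]_n) : {set 'I_q} :=
  [set l | (mpoc_G P l x == 0) && (mpoc_H P l x == 0)]%SET.

Definition W_multipliers (R : realType) (n m p q : nat)
    (P : mpoc R n m p q) (x : 'rV[R]_n)
    (lambda : 'I_m -> R) (rho : 'I_p -> R) (mu nu : 'I_q -> R) : Prop :=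
  [/\ forall i, i \in I_g P x -> 0 <= lambda i,
      forall l, l \in I_0p P x :|: I_00 P x -> 0 <= mu l,
      forall l, l \in I_p0 P x :|: I_00 P x -> 0 <= nu l
    & 0 = gradient (mpoc_f P) x
          + \sum_(i in I_g P x) lambda i *: gradient (mpoc_g P i) x
          + \sum_(j < p) rho j *: gradient (mpoc_h P j) x
          + \sum_(l in I_0p P x :|: I_00 P x)
              mu l *: gradient (mpoc_G P l) x
          + \sum_(l in I_p0 P x :|: I_00 P x)
              nu l *: gradient (mpoc_H P l) x].

Definition S_stationary (R : realType) (n m p q : nat)
    (P : mpoc R n m p q) (x : 'rV[R]_n) : Prop :=
  mpoc_feasible P x /\
  exists (lambda : 'I_m -> R) (rho : 'I_p -> R) (mu nu : 'I_q -> R),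
    W_multipliers P x lambda rho mu nu /\
    (forall l, l \in I_00 P x -> mu l = 0 /\ nu l = 0).

Definition phi_KS (R : realType) (a b : R) : R :=
  if a + b >= 0 then a * b else - (2^-1 * (a ^+ 2 + b ^+ 2)).

Definition mpoc_nlp (R : realType) (n m p q : nat) (phi : R -> R -> R)
    (P : mpoc R n m p q) : nlp R n ('I_m + 'I_q)%type 'I_p :=
  {| nlp_f := mpoc_f P;
     nlp_c := fun s => match s with
       | inl i => mpoc_g P i
       | inr l => fun x => phi (mpoc_G P l x) (mpoc_H P l x)
       end;
     nlp_h := mpoc_h P |}.

(* Main.v *)
Require Import Defs.
From mathcomp Require Import all_boot all_order all_algebra.
From mathcomp Require Import all_classical all_reals all_analysis.
From mathcomp Require Import ring lra.

Set Implicit Arguments.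
Unset Strict Implicit.
Unset Printing Implicit Defensive.

Import Order.TTheory GRing.Theory Num.Theory.
Import numFieldNormedType.Exports.
Local Open Scope ring_scope.

(** The gradient of a constraint $\varphi_{KS}(G_l, H_l) \le 0$ that is active
    at $\bar x$ is $G_l \nabla H_l + H_l \nabla G_l$, even where
    $G_l = H_l = 0$. Indeed $\varphi_{KS}(a, b) = a b - \min(a + b, 0)^2 / 2$
    ([phi_KSE]); activity forces $a + b \ge 0$, and there the correction term is
    of second order, so that it contributes nothing to the gradient
    ([is_derive_sqr_bound], [gradient_phi_KS]).

    Activity means that one of $G_l, H_l$ vanishes and the other one is
    nonnegative ([phi_KS_eq0]). So the gradient is $H_l \nabla G_l$ on
    $I^{0+}$, $G_l \nabla H_l$ on $I^{+0}$ and zero on $I^{00}$, and the two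
    multiplier rules are related by $\mu_l = \lambda_l H_l$ and
    $\nu_l = \lambda_l G_l$ ([sum_multipliers]). These products vanish on
    $I^{00}$, which is the condition separating S-stationarity from
    W-stationarity; on $I^{0+} \cup I^{+0}$ the relation can be solved for a
    nonnegative $\lambda_l$, because the factor that does not vanish is
    positive. *)

Section KanzowSchwartz.
Variable R : realType.
Implicit Types a b : R.

(** One continuously differentiable expression in place of the two cases, so
    that no case distinction has to be made on a neighbourhood of a point when
    differentiating. *)
Lemma phi_KSE a b : phi_KS a b = a * b - 2^-1 * (Num.min (a + b) 0) ^+ 2.
Proof.
rewrite /phi_KS minElt; case: (leP 0 (a + b)) => _; last by field.
by rewrite expr0n mulr0 subr0.
Qed.

Lemma phi_KS_le0 a b : a <= 0 \/ b <= 0 -> phi_KS a b <= 0.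
Proof.
rewrite /phi_KS => ab; case: (leP 0 (a + b)) => sab; last by nra.
by case: ab => ?; nra.
Qed.

Lemma phi_KS_eq0 a b :
  (phi_KS a b == 0) = (a == 0) && (0 <= b) || (0 <= a) && (b == 0).
Proof.
apply/eqP/orP; rewrite /phi_KS; last first.
  case=> /andP[].
    by move=> /eqP-> b0; rewrite add0r b0 mul0r.
  by move=> a0 /eqP->; rewrite addr0 a0 mulr0.
case: (leP 0 (a + b)) => sab; last first.
  by move=> ab0; exfalso; have := sqr_ge0 (a - b); nra.
move=> /eqP; rewrite mulf_eq0 => /orP[] /eqP z; move: sab; rewrite z.
  by rewrite add0r eqxx => ->; left.
by rewrite addr0 eqxx => ->; right.
Qed.

Lemma phi_KS_eq0_addr_ge0 a b : phi_KS a b = 0 -> 0 <= a + b.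
Proof.
by move=> /eqP; rewrite phi_KS_eq0 => /orP[] /andP[] => [/eqP->|? /eqP->]; lra.
Qed.

End KanzowSchwartz.

Section Gradient.
Variables (R : realType) (n : nat).
Implicit Types (F G H S : 'rV[R]_n -> R) (x v : 'rV[R]_n).

(** The difference quotient of [F] at step [t] is at most $|t|$ times the squared
    quotient of [S], which converges. *)
Lemma is_derive_sqr_bound F S x v :
  derivable S x v -> (forall y, `|F y - F x| <= (S y - S x) ^+ 2) ->
  is_derive x v F 0.
Proof.
move=> dS leFS.
pose q := fun t : R => t^-1 *: (S (t *: v + x) - S x).
have cq : (q @ 0^' --> derive S x v)%classic by exact: dS.
have cid : ((fun t : R => t) @ 0^' --> (0 : R))%classic.
  exact: nbhs_dnbhs.
have c0 : ((fun t : R => `|t * (q t * q t)|) @ 0^' --> (0 : R))%classic.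
  suff: ((fun t : R => `|t * (q t * q t)|) @ 0^'
      --> `|0 * (derive S x v * derive S x v)|)%classic by rewrite mul0r normr0.
  by apply: cvg_norm; apply: cvgM cid _; exact: cvgM.
suff c : ((fun t : R => t^-1 *: (F (t *: v + x) - F x)) @ 0^'
    --> (0 : R))%classic.
  by split; [apply/cvg_ex; exists 0 | exact: cvg_lim c].
apply/cvgr0Pnorm_le => e e0.
move/cvgr0Pnorm_le : c0 => /(_ e e0).
apply: filterS2 (nbhs_dnbhs_neq 0) => t t0; apply: le_trans.
rewrite normr_id /q /GRing.scale /= !normrM.
have tN : `|t| != 0 by rewrite normr_eq0.
set d := S _ - S x.
have -> : `|t| * (`|t^-1| * `|d| * (`|t^-1| * `|d|)) = `|t^-1| * d ^+ 2.
  by rewrite -[d ^+ 2]real_normK ?num_real// normfV; field.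
by rewrite ler_wpM2l.
Qed.

Lemma gradient_phi_KS G H x :
  differentiable G x -> differentiable H x -> phi_KS (G x) (H x) = 0 ->
  gradient (fun y => phi_KS (G y) (H y)) x
    = G x *: gradient H x + H x *: gradient G x.
Proof.
move=> dG dH phi0; apply/rowP => i; rewrite !mxE.
set v := delta_mx 0 i.
have gG : derivable G x v by exact: diff_derivable.
have gH : derivable H x v by exact: diff_derivable.
have s0 := phi_KS_eq0_addr_ge0 phi0.
(* $\min(\cdot, 0)^2$ vanishes at a nonnegative argument $a$ and is at most
   $(b - a)^2$ at any other argument $b$. *)
pose N y := 2^-1 * Num.min (G y + H y) 0 ^+ 2.
have dN : is_derive x v N 0.
  apply: (@is_derive_sqr_bound _ (G + H)); first exact: derivableD.
  move=> y; rewrite /N (min_idPr s0) expr0n mulr0 subr0 /= ger0_norm; last first.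
    by rewrite mulr_ge0// sqr_ge0.
  rewrite !fctE; set a := G x + H x in s0 *; set b := G y + H y.
  rewrite minElt; case: (ltP b 0) => b0; [nra|].
  by have := sqr_ge0 (b - a); lra.
have -> : (fun y => phi_KS (G y) (H y)) = G * H - N.
  by apply/funext => y; rewrite phi_KSE.
have := derivableP gG => iG; have := derivableP gH => iH.
by rewrite derive_val subr0.
Qed.

End Gradient.

Section Multipliers.
Variables (R : realType) (n m p q : nat) (P : mpoc R n m p q) (x : 'rV[R]_n).
Implicit Types l : 'I_q.

Let G l := mpoc_G P l x.
Let H l := mpoc_H P l x.

Lemma in_I_0pU00 l :
  (l \in I_0p P x :|: I_00 P x)%SET = (G l == 0) && (0 <= H l).
Proof.
by rewrite !inE -andb_orr [0 <= H l]le_eqVlt [0 == H l]eq_sym [in RHS]orbC.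
Qed.

Lemma in_I_p0U00 l :
  (l \in I_p0 P x :|: I_00 P x)%SET = (0 <= G l) && (H l == 0).
Proof.
by rewrite !inE -andb_orl [0 <= G l]le_eqVlt [0 == G l]eq_sym [in RHS]orbC.
Qed.

Lemma phi_KS_active l :
  (phi_KS (G l) (H l) == 0) =
  (l \in I_0p P x :|: I_00 P x)%SET || (l \in I_p0 P x :|: I_00 P x)%SET.
Proof. by rewrite phi_KS_eq0 in_I_0pU00 in_I_p0U00. Qed.

(** On an active index outside $I^{0+} \cup I^{00}$ (resp. outside
    $I^{+0} \cup I^{00}$) the coefficient $\lambda_l H_l$ (resp.
    $\lambda_l G_l$) is zero, so both sides collect the same terms although
    they range over different index sets. *)
Lemma sum_multipliers (la mu nu : 'I_q -> R) :
  (forall l, differentiable (mpoc_G P l) x) ->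
  (forall l, differentiable (mpoc_H P l) x) ->
  (forall l, l \in (I_0p P x :|: I_00 P x)%SET -> mu l = la l * H l) ->
  (forall l, l \in (I_p0 P x :|: I_00 P x)%SET -> nu l = la l * G l) ->
  \sum_(l in (I_0p P x :|: I_00 P x)%SET) mu l *: gradient (mpoc_G P l) x
  + \sum_(l in (I_p0 P x :|: I_00 P x)%SET) nu l *: gradient (mpoc_H P l) x
  = \sum_(l | phi_KS (G l) (H l) == 0)
      la l *: gradient (fun y => phi_KS (mpoc_G P l y) (mpoc_H P l y)) x.
Proof.
move=> dG dH muE nuE.
rewrite big_mkcond [X in _ + X]big_mkcond [RHS]big_mkcond -big_split /=.
apply: eq_bigr => l _.
have [phi0|] := boolP (phi_KS (G l) (H l) == 0); last first.
  by rewrite phi_KS_active negb_or => /andP[/negbTE-> /negbTE->]; rewrite addr0.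
rewrite gradient_phi_KS//; last exact/eqP.
rewrite scalerDr !scalerA addrC -/(G l) -/(H l).
congr (_ + _).
  case: ifPn => [/nuE -> //|]; move: phi0; rewrite phi_KS_active => /orP[|->//].
  by rewrite in_I_0pU00 => /andP[/eqP-> _]; rewrite mulr0 scale0r.
case: ifPn => [/muE -> //|]; move: phi0; rewrite phi_KS_active => /orP[->//|].
by rewrite in_I_p0U00 => /andP[_ /eqP->]; rewrite mulr0 scale0r.
Qed.

End Multipliers.

Theorem proposition3p2 (R : realType) (n m p q : nat)
    (hn : (0 < n)%N) (hm : (0 < m)%N) (hp : (0 < p)%N) (hq : (0 < q)%N)
    (P : mpoc R n m p q)
    (hf : continuously_differentiable (mpoc_f P))
    (hg : forall i : 'I_m, continuously_differentiable (mpoc_g P i))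
    (hh : forall j : 'I_p, continuously_differentiable (mpoc_h P j))
    (hG : forall l : 'I_q, continuously_differentiable (mpoc_G P l))
    (hH : forall l : 'I_q, continuously_differentiable (mpoc_H P l))
    (x : 'rV[R]_n) (hx : mpoc_feasible P x) :
  S_stationary P x <-> KKT_point (mpoc_nlp (@phi_KS R) P) x.
Proof.
have dG l : differentiable (mpoc_G P l) x by case: (hG l).
have dH l : differentiable (mpoc_H P l) x by case: (hH l).
have sum_g (la : 'I_m -> R) :
    \sum_(i in I_g P x) la i *: gradient (mpoc_g P i) x
    = \sum_(i | mpoc_g P i x == 0) la i *: gradient (mpoc_g P i) x.
  by apply: eq_bigl => i; rewrite inE.
have regroup (V : zmodType) (a b c d e : V) :
  a + b + c + d + e = a + (b + (d + e)) + c by rewrite !addrA -!(addrAC _ c).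
split=> [[_ [la [rho [mu [nu [[la0 mu0 nu0 eq0] S0]]]]]]|].
- split.
    case: hx => g0 h0 GH0; split=> // -[i|l] /=; first exact: g0.
    exact: phi_KS_le0.
  (* On $I^{00}$ the quotient by zero is zero, in accordance with
     $\mu_l = \nu_l = 0$ there. *)
  pose ka l := if 0 < mpoc_H P l x then mu l / mpoc_H P l x
               else nu l / mpoc_G P l x.
  exists (fun s => match s with inl i => la i | inr l => ka l end), rho.
  split=> [[i|l] /=|].
  + by move=> gi0; apply: la0; rewrite inE gi0.
  + move=> /eqP; rewrite phi_KS_active /ka => act.
    case: ltP => Hl.
      have H0 := gt_eqF Hl.
      move: act; rewrite in_I_p0U00 H0 andbF orbF => /[dup]/mu0 + _.
      by move=> ?; rewrite divr_ge0// ltW.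
    have lB : (l \in I_p0 P x :|: I_00 P x)%SET.
      case/orP: act => //; rewrite in_I_0pU00 in_I_p0U00 => /andP[/eqP-> H0].
      by rewrite lexx eq_le Hl H0.
    have := lB; rewrite in_I_p0U00 => /andP[G0 _].
    by rewrite divr_ge0// nu0.
  + rewrite /= big_sumType/= {1}eq0 regroup sum_g.
    rewrite (sum_multipliers (la := ka))// => l lA.
      move: (lA); rewrite in_I_0pU00 le_eqVlt => /andP[G0] /orP[H0|H0].
        rewrite -(eqP H0) mulr0.
        by have [] := S0 l; first by rewrite inE G0 eq_sym H0.
      by rewrite /ka H0 divfK// gt_eqF.
    move: (lA); rewrite in_I_p0U00 => /andP[G0 /eqP H0].
    rewrite /ka H0 ltxx; have [Gl|Gl] := eqVneq (mpoc_G P l x) 0.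
      rewrite Gl mulr0.
      by have [] := S0 l; first by rewrite inE Gl H0 eqxx.
    by rewrite divfK.
- move=> [_ [la [rho [la0 eq0]]]]; split=> //.
  exists (fun i => la (inl i)), rho, (fun l => la (inr l) * mpoc_H P l x),
    (fun l => la (inr l) * mpoc_G P l x).
  split; last by move=> l; rewrite inE => /andP[/eqP-> /eqP->]; rewrite mulr0.
  split.
  + by move=> i; rewrite inE => /eqP; exact: (la0 (inl i)).
  + move=> l lA; apply: mulr_ge0.
      by apply: (la0 (inr l)); apply/eqP; rewrite /= phi_KS_active lA.
    by move: lA; rewrite in_I_0pU00 => /andP[].
  + move=> l lB; apply: mulr_ge0.
      by apply: (la0 (inr l)); apply/eqP; rewrite /= phi_KS_active lB orbT.
    by move: lB; rewrite in_I_p0U00 => /andP[].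
  + rewrite regroup sum_g (sum_multipliers (la := fun l => la (inr l)))//.
    by move: eq0; rewrite /= big_sumType.
Qed.
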